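(* Let $n\ge3$ be odd and let $\mathbb{F}$ be an arbitrary field. Let $D_{2n}=\langle a,b\mid a^n=1=b^2,\ (ab)^2=1\rangle$, let $s,t$ be integers with $1\le s\le n-1$, $0\le t\le n-1$, and let $\sigma_0$ be the $\mathbb{F}$-linear extension to $\mathbb{F}D_{2n}$ of the group endomorphism of $D_{2n}$ given by $\sigma_0(a)=a^s$, $\sigma_0(b)=a^tb$. Denote by $m=|\sigma_0(a)|$ the order of $\sigma_0(a)$, $d=\frac nm$, and let $j_0\in\{0,1,\dots,s-1\}$ with $t\equiv j_0\pmod s$. Then the dimension of $\mathrm{Inn}_{\sigma_0}(\mathbb{F}D_{2n})$ over $\mathbb{F}$ is $\frac12(3n-d)-1$ and a basis is $\mathcal{B}_0=\{D_g\mid g\in S\}$, where $$S=\left\{a^k\;\middle|\;1\le k\le\tfrac{n-1}2\right\}\cup\bigcup_{u=j_0}^{j_0+\frac{d-1}2}\{a^{2si}a^ub\mid 1\le i\le m-1\}\cup\bigcup_{u=j_0+1}^{j_0+\frac{d-1}2}\{a^{2si}a^{2j_0-u}b\mid 0\le i\le m-1\}.$$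
   Context: For a unital algebra endomorphism $\sigma$ of $\mathbb{F}D_{2n}$ and $\beta\in\mathbb{F}D_{2n}$, $D_\beta$ denotes the inner $\sigma$-derivation $D_\beta(\alpha)=\beta\sigma(\alpha)-\sigma(\alpha)\beta$ of $\mathbb{F}D_{2n}$, and $\mathrm{Inn}_\sigma(\mathbb{F}D_{2n})=\{D_\beta\mid\beta\in\mathbb{F}D_{2n}\}$, an $\mathbb{F}$-vector space under pointwise operations. *)

(* Defs.v *)
From HB Require Import structures.
From mathcomp Require Import all_boot all_order all_algebra all_fingroup.
From mathcomp Require Import all_solvable all_field.

Set Implicit Arguments.
Unset Strict Implicit.
Unset Printing Implicit Defensive.

Import GRing.Theory.
Local Open Scope ring_scope.

(* The group algebra F[gT]: functions gT -> F under convolution. The type is an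
   alias so that it does not inherit the pointwise product of {ffun gT -> F}. *)
Definition galg (F : fieldType) (gT : finGroupType) : Type := {ffun gT -> F^o}.

Section GroupAlgebra.

Variables (F : fieldType) (gT : finGroupType).
Implicit Types x y z : galg F gT.

HB.instance Definition _ := Vector.copy (galg F gT) {ffun gT -> F^o}.

Definition galg_elt (g : gT) : galg F gT := [ffun h => (h == g)%:R].

Definition galg_mul x y : galg F gT :=
  [ffun h => \sum_g (x g : F) * (y (g^-1 * h)%g : F)].

Lemma galg_mulA : associative galg_mul.
Proof.
move=> x y z; apply/ffunP=> h; rewrite !ffunE.
under eq_bigr => g _ do rewrite ffunE mulr_sumr.
under [RHS]eq_bigr => g _ do rewrite ffunE mulr_suml.
rewrite [RHS]exchange_big /=; apply: eq_bigr => g _.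
rewrite [RHS](reindex_inj (mulgI g)) /=; apply: eq_bigr => k _.
by rewrite mulKg invMg -!mulgA mulrA.
Qed.

Lemma galg_mul1l : left_id (galg_elt 1%g) galg_mul.
Proof.
move=> x; apply/ffunP=> h; rewrite ffunE (bigD1 1%g) //= ffunE eqxx mul1r.
rewrite big1 ?addr0 ?invg1 ?mul1g // => g /negPf ng.
by rewrite ffunE ng mul0r.
Qed.

Lemma galg_mul1r : right_id (galg_elt 1%g) galg_mul.
Proof.
move=> x; apply/ffunP=> h; rewrite ffunE (bigD1 h) //= ffunE mulVg eqxx mulr1.
rewrite big1 ?addr0 // => g ng.
by rewrite ffunE -eq_mulVg1 (negPf ng) mulr0.
Qed.

Lemma galg_mulDl : left_distributive galg_mul +%R.
Proof.
move=> x y z; apply/ffunP=> h; rewrite !ffunE -big_split /=.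
by apply: eq_bigr => g _; rewrite ffunE mulrDl.
Qed.

Lemma galg_mulDr : right_distributive galg_mul +%R.
Proof.
move=> x y z; apply/ffunP=> h; rewrite !ffunE -big_split /=.
by apply: eq_bigr => g _; rewrite ffunE mulrDr.
Qed.

Lemma galg_one_neq0 : galg_elt 1%g != 0.
Proof.
by apply/eqP=> /ffunP/(_ 1%g)/eqP; rewrite !ffunE eqxx oner_eq0.
Qed.

HB.instance Definition _ := GRing.Zmodule_isNzRing.Build (galg F gT)
  galg_mulA galg_mul1l galg_mul1r galg_mulDl galg_mulDr galg_one_neq0.

Lemma galg_scaleAl (c : F) x y : c *: (x * y) = (c *: x) * y.
Proof.
apply/ffunP=> h; rewrite !ffunE scaler_sumr.
by apply: eq_bigr => g _; rewrite ffunE /GRing.scale /= mulrA.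
Qed.

Lemma galg_scaleAr (c : F) x y : c *: (x * y) = x * (c *: y).
Proof.
apply/ffunP=> h; rewrite !ffunE scaler_sumr.
by apply: eq_bigr => g _; rewrite ffunE /GRing.scale /= mulrCA.
Qed.

HB.instance Definition _ :=
  GRing.Lmodule_isLalgebra.Build F (galg F gT) galg_scaleAl.
HB.instance Definition _ :=
  GRing.Lalgebra_isAlgebra.Build F (galg F gT) galg_scaleAr.
HB.instance Definition _ := Algebra_isFalgebra.Build F (galg F gT).

Lemma galg_elt1 : galg_elt 1%g = 1.
Proof. by []. Qed.

Lemma galg_eltM (g h : gT) : galg_elt (g * h)%g = galg_elt g * galg_elt h.
Proof.
apply/ffunP=> k; rewrite !ffunE (bigD1 g) //= !ffunE eqxx mul1r.
rewrite big1 ?addr0 => [|l /negPf nl]; last by rewrite ffunE nl mul0r.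
by rewrite -(inj_eq (mulgI g) (g^-1 * k)%g h) mulKVg.
Qed.

Lemma galg_sum x : x = \sum_g (x g : F) *: galg_elt g.
Proof.
apply/ffunP=> h; rewrite sum_ffunE (bigD1 h) //= !ffunE eqxx.
rewrite big1 ?addr0 => [|g]; first by rewrite /GRing.scale /= mulr1.
by rewrite eq_sym => /negPf ng; rewrite !ffunE ng /GRing.scale /= mulr0.
Qed.

End GroupAlgebra.

(* The F-linear extension of a group homomorphism to the group algebras. *)
Definition galg_ext (F : fieldType) (gT hT : finGroupType)
    (phi : {morphism [set: gT] >-> hT}) (x : galg F gT) : galg F hT :=
  \sum_g (x g : F) *: galg_elt F (phi g).

Section Extension.

Variables (F : fieldType) (gT hT : finGroupType).
Variable phi : {morphism [set: gT] >-> hT}.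
Local Notation ext := (@galg_ext F gT hT phi).

Lemma galg_ext_linear : linear ext.
Proof.
move=> c x y; rewrite /galg_ext scaler_sumr -big_split /=.
by apply: eq_bigr => g _; rewrite !ffunE scalerDl scalerA.
Qed.

HB.instance Definition _ :=
  GRing.isLinear.Build F (galg F gT) (galg F hT) _ ext galg_ext_linear.

Lemma galg_ext_elt (g : gT) : ext (galg_elt F g) = galg_elt F (phi g).
Proof.
rewrite /galg_ext (bigD1 g) //= ffunE eqxx scale1r.
by rewrite big1 ?addr0 // => h /negPf nh; rewrite ffunE nh scale0r.
Qed.

Lemma galg_ext_monoid : monoid_morphism ext.
Proof.
split=> [|x y]; first by rewrite -galg_elt1 galg_ext_elt morph1.
rewrite [x in LHS]galg_sum [y in LHS]galg_sum mulr_suml linear_sum.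
rewrite [X in _ = X * _]/galg_ext mulr_suml; apply: eq_bigr => g _.
rewrite mulr_sumr linear_sum [X in _ = _ * X]/galg_ext mulr_sumr.
apply: eq_bigr => h _.
rewrite -!scalerAl -!scalerAr -!galg_eltM !linearZ /= galg_ext_elt.
by rewrite morphM ?inE // !scalerA [X in X *: _]mulrC.
Qed.

HB.instance Definition _ :=
  GRing.isMonoidMorphism.Build (galg F gT) (galg F hT) ext galg_ext_monoid.

End Extension.

Section InnerDerivations.

Variables (F : fieldType) (A : falgType F) (sigma : {lrmorphism A -> A}).

Definition sder (beta : A) (alpha : A) : A :=
  beta * sigma alpha - sigma alpha * beta.

Lemma sder_linear beta : linear (sder beta).
Proof.
move=> c x y; rewrite /sder linearP mulrDr mulrDl -scalerAl -scalerAr.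
by rewrite scalerBr opprD addrACA.
Qed.

HB.instance Definition _ beta :=
  GRing.isLinear.Build F A A _ (sder beta) (sder_linear beta).

Definition inner_der (beta : A) : 'End(A) := linfun (sder beta).

Lemma inner_derE beta alpha :
  inner_der beta alpha = beta * sigma alpha - sigma alpha * beta.
Proof. by rewrite lfunE. Qed.

Lemma inner_der_linear : linear inner_der.
Proof.
move=> c x y; apply/lfunP=> z; rewrite add_lfunE scale_lfunE !inner_derE.
by rewrite mulrDr mulrDl -scalerAl -scalerAr scalerBr opprD addrACA.
Qed.

HB.instance Definition _ :=
  GRing.isLinear.Build F A 'End(A) _ inner_der inner_der_linear.

(* The set of all inner sigma-derivations, see InnP. *)
Definition Inn : {vspace 'End(A)} := limg (linfun inner_der).

Lemma InnP (f : 'End(A)) :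
  reflect (exists beta, f = inner_der beta) (f \in Inn).
Proof.
apply: (iffP memv_imgP) => [[b _ ->]|[b ->]]; first by exists b; rewrite lfunE.
by exists b; rewrite ?memvf // lfunE.
Qed.

End InnerDerivations.

(* gT = < a, b | a^n = 1 = b^2, (ab)^2 = 1 > with a and b the two generators of
   the presentation. The presentation by itself only provides some pair of
   generators satisfying the relations, so the first conditions identify a and
   b as such a pair. *)
Definition is_dihedral (n : nat) (gT : finGroupType) (a b : gT) : Prop :=
  [/\ <[a]> <*> <[b]> = [set: gT], a ^+ n = 1, b ^+ 2 = 1, (a * b) ^+ 2 = 1
    & [set: gT] \isog Grp (x : y : x ^+ n = y ^+ 2 = 1, (x * y) ^+ 2 = 1)]%g.

(* In the last union a^(2 j0 - u) is a ^+ (2 * j0) * a ^- u, because the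
   exponent 2 j0 - u may be negative. *)
Definition basis_index (gT : finGroupType) (a b : gT) (n s m d j0 : nat) :
    {set gT} :=
  ([set a ^+ (k : 'I_n) | k : 'I_n & (1 <= k <= (n - 1) %/ 2)%N]
   :|: \bigcup_(j0 <= u < (j0 + (d - 1) %/ 2).+1)
         [set a ^+ (2 * s * i) * a ^+ u * b | i : 'I_m & (1 <= i)%N]
   :|: \bigcup_(j0.+1 <= u < (j0 + (d - 1) %/ 2).+1)
         [set a ^+ (2 * s * i) * (a ^+ (2 * j0) * a ^- u) * b | i : 'I_m])%g.

(* Main.v *)
Require Import Defs.
From HB Require Import structures.
From mathcomp Require Import all_boot all_order all_algebra all_fingroup.
From mathcomp Require Import all_solvable all_field.
From mathcomp Require Import zify ring.

Set Implicit Arguments.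
Unset Strict Implicit.
Unset Printing Implicit Defensive.

Import Order.TTheory GRing.Theory.
Local Open Scope ring_scope.

(** The derivation D_x attached to x in F[G] vanishes exactly when x commutes
    with the image of sigma, that is, when x, seen as a function on G, is
    constant on the conjugacy classes of the subgroup H = phi(G). So Inn is
    F[G] modulo the functions constant on the H-classes: a direct sum, over the
    classes C, of F^C modulo the constant functions. In F^C / F.1 any #|C| - 1
    of the indicator functions of points form a basis. Hence, for any finite
    group, the D_g with g in S form a basis of Inn as soon as S misses exactly
    one element of every H-class ([basis_inner_der]).

    It remains to check this property for the given set S
    ([card_image_class_misses]). Let d = gcd(n, s); as d divides s and n, the
    hypothesis on j0 gives t = j0 modulo d. As n is odd, the multiples of 2s
    modulo n are the n/d multiples of d, so conjugation by H moves a^x b to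
    every a^y b with y = x or y = 2 j0 - x modulo d, and a^x to a^x and a^-x.
    By the oddness of n and d, the residues modulo n, resp. modulo d and
    centred at j0, can be taken between -(n-1)/2 and (n-1)/2, resp. -(d-1)/2
    and (d-1)/2, and the classes identify opposite ones. The elements outside
    S are the a^-k with 0 <= k <= (n-1)/2 and the a^(j0+v) b with
    0 <= v <= (d-1)/2 ([basis_indexCP]): one in each class. Counting them gives
    the dimension 2n - (n+1)/2 - (d+1)/2 = (3n - d)/2 - 1.

    Exponents of a are taken in int, so that conjugation formulas need no case
    distinction, and equality of group elements becomes divisibility by n. *)

(** * Inner derivations of a group algebra *)

Section GroupAlgebraBasis.

Variables (F : fieldType) (gT : finGroupType).
Implicit Types (x : galg F gT) (S : {set gT}) (g h k : gT).
Local Notation elt := (@galg_elt F gT).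

Lemma galg_mul_eltr x k h : (x * elt k) h = x (h * k^-1)%g.
Proof.
rewrite ffunE (bigD1 (h * k^-1)%g) //= ffunE invMg invgK mulgKV eqxx mulr1.
rewrite big1 ?addr0 // => g neq_g; rewrite ffunE.
case: eqP => [eq_k|_]; last by rewrite mulr0.
by case/eqP: neq_g; rewrite -eq_k invMg invgK mulKVg.
Qed.

Lemma galg_mul_eltl x k h : (elt k * x) h = x (k^-1 * h)%g.
Proof.
rewrite ffunE (bigD1 k) //= ffunE eqxx mul1r.
by rewrite big1 ?addr0 // => g /negPf neq_g; rewrite ffunE neq_g mul0r.
Qed.

Lemma galg_elt_basis : basis_of fullv [seq elt g | g in gT].
Proof.
have sizeE : size [seq elt g | g in gT] = #|gT| by rewrite size_image.
rewrite basisEdim; apply/andP; split.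
  apply/subvP=> x _; rewrite [x]galg_sum; apply: rpred_sum => g _.
  by apply/rpredZ/memv_span/map_f; rewrite mem_enum.
by rewrite sizeE dimvf /dim /= muln1.
Qed.

Lemma galg_elt_free S : free [seq elt g | g in S].
Proof.
apply: (@catl_free _ _ [seq elt g | g in ~: S]).
rewrite -map_cat -(@perm_free _ _ [seq elt g | g in gT]).
  exact: basis_free galg_elt_basis.
apply: perm_map; apply: uniq_perm; rewrite ?enum_uniq //.
  rewrite cat_uniq !enum_uniq andbT /=; apply/hasPn=> g /=.
  by rewrite !mem_enum inE.
by move=> g; rewrite mem_cat !mem_enum !inE orbN.
Qed.

Lemma galg_elt_spanP S x :
  reflect (forall g, g \notin S -> x g = 0) (x \in <<[seq elt g | g in S]>>%VS).
Proof.
apply: (iffP idP) => [/(free_span (galg_elt_free S))[c -> _] g gS | x0].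
  rewrite big_map sum_ffunE big1_seq // => h /andP[_]; rewrite mem_enum => hS.
  rewrite !ffunE; case: eqP => [gh|_]; last by rewrite scaler0.
  by rewrite gh hS in gS.
rewrite [x]galg_sum (bigID (mem S)) /= [X in _ + X]big1 => [|g gS].
  rewrite addr0; apply: rpred_sum => g gS.
  by apply/rpredZ/memv_span/map_f; rewrite mem_enum.
by rewrite x0 // scale0r.
Qed.

Variable phi : {morphism [set: gT] >-> gT}.
Local Notation sigma :=
  (@galg_ext F gT gT phi : {lrmorphism galg F gT -> galg F gT}).
Local Notation H := (phi @* [set: gT])%g.

(** Evaluating x * phi(k) = phi(k) * x at the point g * phi(k) compares x g
    with x (g ^ phi k); by linearity the elements of the group suffice. *)
Lemma inner_der_eq0P x :
  reflect (forall h g, h \in H -> x (g ^ h)%g = x g)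
          (inner_der sigma x == 0).
Proof.
apply: (iffP eqP) => [Dx0 _ g /morphimP[k _ _ ->] | xJ].
  have /eqP : inner_der sigma x (elt k) = 0 by rewrite Dx0 lfunE.
  rewrite inner_derE /= galg_ext_elt subr_eq0 => /eqP/ffunP/(_ (g * phi k)%g).
  by rewrite galg_mul_eltr galg_mul_eltl mulgK conjgE.
apply/lfunP=> y; rewrite inner_derE /= lfunE /= [y]galg_sum linear_sum /=.
rewrite mulr_sumr mulr_suml -sumrB big1 // => k _.
rewrite linearZ /= galg_ext_elt -scalerAr -scalerAl -scalerBr.
apply/eqP; rewrite scaler_eq0 subr_eq0; apply/orP; right.
apply/eqP/ffunP=> g; rewrite galg_mul_eltr galg_mul_eltl.
by rewrite -(xJ (phi k)) ?mem_morphim ?inE // conjgE mulgKV.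
Qed.

(** The hypothesis on S says that the span of S is a complement of the kernel of
    x |-> D_x: an element of the kernel supported on S has a zero in each class,
    hence vanishes on it; and the sum of a class is in the kernel, so the
    derivation of its missing element lies in the span of the others. *)
Lemma basis_inner_der S :
    (forall g, #|(g ^: H :\: S)%g| = 1%N) ->
  basis_of (Inn sigma) [seq inner_der sigma (elt g) | g in S].
Proof.
move=> missS; pose f := linfun (inner_der sigma).
have -> : [seq inner_der sigma (elt g) | g in S] = map f [seq elt g | g in S].
  by rewrite -map_comp; apply: eq_map => g /=; rewrite lfunE.
set X := [seq elt g | g in S].
have -> : Inn sigma = (f @: <<X>>)%VS.
  apply/eqP; rewrite eqEsubv; apply/andP; split; last by rewrite limgS ?subvf.
  rewrite /Inn -(span_basis galg_elt_basis) limg_span.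
  apply/span_subvP=> _ /mapP[_ /mapP[g _ ->] ->].
  have [gS | gS] := boolP (g \in S).
    by apply/memv_img/memv_span/map_f; rewrite mem_enum.
  (* z is elt g minus the sum of the class of g: it has the same image as elt g
     and no coefficient outside S. *)
  pose z := [ffun h => - (h \in (g ^: H)%g)%:R] + elt g : galg F gT.
  suff -> : linfun (inner_der sigma) (elt g) = f z.
    apply/memv_img/galg_elt_spanP => h hS; rewrite !ffunE.
    have /eqP/cards1P[r rE] := missS g.
    have gr : g = r by apply/set1P; rewrite -rE inE gS class_refl.
    case: eqP => [->|/eqP hg]; first by rewrite class_refl addNr.
    suff /negPf -> : h \notin (g ^: H)%g by rewrite oppr0 addr0.
    apply: contra hg => hg; rewrite gr; apply/eqP/set1P.
    by rewrite -rE inE hS.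
  rewrite /z linearD /= -[LHS]add0r; congr (_ + _).
  rewrite lfunE; apply/esym/eqP/inner_der_eq0P => h k hH; rewrite !ffunE.
  by rewrite (class_transl _ (memJ_class k hH)).
apply: limg_basis_of; last by rewrite /basis_of eqxx galg_elt_free.
apply/eqP; rewrite -subv0; apply/subvP=> x.
rewrite memv_cap memv_ker lfunE memv0 => /andP[].
move=> /galg_elt_spanP x0 /inner_der_eq0P xJ.
apply/eqP/ffunP=> g; rewrite [RHS]ffunE.
have /eqP/cards1P[r rE] := missS g.
have : r \in (g ^: H :\: S)%g by rewrite rE set11.
by case/setDP=> /imsetP[h hH ->] /x0; rewrite xJ.
Qed.

End GroupAlgebraBasis.

(** * Congruences modulo an odd number *)

Section Congruences.

Lemma dvdz_small (e : nat) (z : int) :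
  (e %| z)%Z -> (- e%:Z < z < e%:Z)%R -> z = 0.
Proof.
move=> /dvdzP[q ->] bnd; have [q_lt0|q_gt0|->] := ltgtP q 0; last by rewrite mul0r.
  nia.
nia.
Qed.

Lemma dvdz_sub_small (e v w : nat) :
  (v <= (e - 1) %/ 2)%N -> (w <= (e - 1) %/ 2)%N -> (0 < e)%N ->
  (e %| v%:Z - w%:Z)%Z -> v = w.
Proof. by move=> v_le w_le e_gt0 /dvdz_small; lia. Qed.

Lemma dvdz_add_small (e v w : nat) :
  (v <= (e - 1) %/ 2)%N -> (w <= (e - 1) %/ 2)%N -> (0 < e)%N ->
  (e %| v%:Z + w%:Z)%Z -> v = 0%N /\ w = 0%N.
Proof. by move=> v_le w_le e_gt0 /dvdz_small; lia. Qed.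

(** An odd modulus e has the balanced residues from -(e-1)/2 to (e-1)/2. The
    second case excludes 0, which makes the cases disjoint. *)
Lemma residue_split (e : nat) (x : int) : odd e ->
  (exists2 v : nat, (v <= (e - 1) %/ 2)%N & (e %| x - v%:Z)%Z) \/
  (exists2 v : nat, (1 <= v <= (e - 1) %/ 2)%N & (e %| x + v%:Z)%Z).
Proof.
move=> e_odd; have e_gt0 : 0 < e%:Z by lia.
have e_neq0 : e%:Z != 0 by lia.
have := modz_ge0 x e_neq0; have := ltz_pmod x e_gt0.
have := divz_eq x e; move: (x %/ e)%Z (x %% e)%Z => q w xE w_lt w_ge0.
have [w_le|w_gt] := leP w ((e - 1) %/ 2)%N%:Z.
  left; exists `|w|%N; first lia.
  by apply/dvdzP; exists q; lia.
right; exists `|e%:Z - w|%N; first lia.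
by apply/dvdzP; exists (q + 1); lia.
Qed.

Variables n s : nat.
Hypotheses (n_odd : odd n).
Local Notation d := (gcdn n s).
Local Notation m := (n %/ d)%N.

(** As n is odd, gcd(n, 2s) = gcd(n, s). *)
Lemma bezout_2s : exists u v : int, u * (2 * s%:Z) + v * n%:Z = d.
Proof.
have [u [v uvE]] := Bezoutz (2 * s)%N%:Z n; exists u, v.
rewrite -[2 * s%:Z]/(2 * s)%:Z uvE /gcdz !absz_nat.
by rewrite gcdnC mulnC Gauss_gcdl ?coprimen2.
Qed.

(** d is a combination of 2s and n, so the multiples of d are those of 2s
    modulo n; and 2sm is a multiple of n, which bounds i. *)
Lemma multiple_mod (z : int) :
  (d %| z)%Z -> exists2 i : nat, (i < m)%N & (n %| z - 2 * s%:Z * i%:Z)%Z.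
Proof.
have n_gt0 : (0 < n)%N by case: n n_odd.
have d_gt0 : (0 < d)%N by rewrite gcdn_gt0 n_gt0.
have nE : n = (m * d)%N by rewrite divnK ?dvdn_gcdl.
have m_gt0 : (0 < m)%N by lia.
have [s' sE] := dvdnP (dvdn_gcdr n s).
have [u [v uvE]] := bezout_2s.
case/dvdzP=> q ->; exists `|((q * u) %% m)%Z|%N.
  have := ltz_mod (q * u) (_ : m%:Z != 0); have := modz_ge0 (q * u) (_ : m%:Z != 0); lia.
rewrite gez0_abs ?modz_ge0 //; last lia.
(* By Bezout q * d = 2s * y modulo n, and y only matters modulo m. *)
set y := (q * u)%R; apply/dvdzP; exists (q * v + 2 * s'%:Z * (y %/ m)%Z).
have -> : (y %% m)%Z = y - (y %/ m)%Z * m by have := divz_eq y m; lia.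
have sZ : s%:Z * m%:Z = s'%:Z * n%:Z by rewrite [in RHS]nE {1}sE; lia.
rewrite -uvE /y; move: (q * u %/ m)%Z => k.
transitivity (q * v * n%:Z + 2 * k * (s%:Z * m%:Z)); first by ring.
by rewrite sZ; ring.
Qed.

Lemma multiple_eq0 (i : nat) :
  (i < m)%N -> (n %| 2 * s%:Z * i%:Z)%Z -> i = 0%N.
Proof.
move=> i_lt /dvdzP[q qE]; have [u [v uvE]] := bezout_2s.
have nE : n = (m * d)%N by rewrite divnK ?dvdn_gcdl.
have d_gt0 : (0 < d)%N by rewrite gcdn_gt0; case: n n_odd.
have di_lt : (d * i < n)%N by rewrite [X in (_ < X)%N]nE mulnC ltn_pmul2r.
(* Multiplying the Bezout relation by i: n divides d * i < d * m = n. *)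
suff : d%:Z * i%:Z = 0 
  by case=> /eqP; rewrite muln_eq0 eqn0Ngt d_gt0 => /eqP.
apply: (@dvdz_small n); last first.
  by rewrite -PoszM; move: (d * i)%N di_lt => e; lia.
apply/dvdzP; exists (u * q + v * i%:Z); rewrite -uvE.
transitivity (u * (2 * s%:Z * i%:Z) + v * i%:Z * n%:Z); first by ring.
by rewrite qE; ring.
Qed.

End Congruences.

(** * Rotations and reflections of a dihedral group *)

Section Dihedral.
Local Open Scope group_scope.
Variables (n : nat) (gT : finGroupType) (a b : gT).
Hypotheses (n_gt1 : (1 < n)%N) (dih_ab : is_dihedral n a b).

Lemma dihedral_b2 : b * b = 1. Proof. by case: dih_ab. Qed.

Lemma dihedral_bV : b^-1 = b.
Proof. by apply/eqP; rewrite eq_invg_mul dihedral_b2. Qed.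

Lemma dihedral_aJb : a ^ b = a^-1.
Proof.
case: dih_ab => _ _ _ ab2 _; apply/eqP; rewrite eq_sym eq_invg_mul.
by rewrite conjgE dihedral_bV -[X in _ == X]ab2 expgS expg1 !mulgA.
Qed.

(** The relations alone would allow proper quotients; the universal property of
    the presentation gives a surjection onto the concrete dihedral group. *)
Lemma dihedral_card_ge : (n.*2 <= #|gT|)%N.
Proof.
have [_ _ _ _ isoG] := dih_ab.
have homD := isoGrp_hom (Grp_dihedral n_gt1).
have /existsP[[x y] /= /eqP[dxy xn y2 xy]] := homD.
rewrite -(card_dihedral n_gt1) -[#|gT|]cardsT; apply: leq_homg.
rewrite isoG; apply/existsP; exists (x, y) => /=; apply/eqP; rewrite -dxy xn y2.
have yV : y^-1 = y by apply/eqP; rewrite eq_invg_mul -expg2 y2.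
do !congr (_, _).
by rewrite expgS expg1 -mulgA -[X in X * (x * _)]yV -conjgE xy mulgV.
Qed.

Lemma dihedral_genE : <[a]> * <[b]> = [set: gT].
Proof.
have [<- _ _ _ _] := dih_ab; rewrite -norm_joinEr // cycle_subG.
by apply/normP; rewrite -cycleJ dihedral_aJb cycleV.
Qed.

Lemma dihedral_card_order : #[a] = n /\ #|gT| = n.*2.
Proof.
have [_ an b2 _ _] := dih_ab.
have := dihedral_card_ge; rewrite -[#|gT|]cardsT -dihedral_genE.
have a_le : (#[a] <= n)%N by rewrite dvdn_leq ?order_dvdn ?an // ltnW.
have b_le : (#[b] <= 2)%N by rewrite dvdn_leq ?order_dvdn ?b2.
have := mul_cardG <[a]> <[b]>; rewrite -!orderE.
have := cardG_gt0 (<[a]> :&: <[b]>).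
set c := #|_|; set i := #|_| => c_gt0 ab_eq i_ge.
have ab_le : (#[a] * #[b] <= n * 2)%N by apply: leq_mul.
have i_le : (i <= i * c)%N by rewrite leq_pmulr.
have n_le : (n * 2 <= #[a] * #[b])%N by lia.
split; last by lia.
apply/eqP; rewrite eqn_leq a_le -(leq_pmul2r (isT : 0 < 2)%N).
by rewrite (leq_trans n_le) // leq_mul2l b_le orbT.
Qed.

(** a^k for an integer k: the exponent is replaced by its residue modulo n,
    which is harmless as a has order n. *)
Definition rotation (k : int) : gT := a ^+ `|(k %% n)%Z|%N.
Definition reflection (k : int) : gT := rotation k * b.

Let n_neq0 : n%:Z != 0. Proof. by lia. Qed.

Lemma rotation_nat (k : nat) : rotation k = a ^+ k.
Proof.
rewrite /rotation modz_nat absz_nat.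
by have [<- _] := dihedral_card_order; rewrite expg_mod_order.
Qed.

Lemma rotation_eq x y : (rotation x == rotation y) = (n %| x - y)%Z.
Proof.
have [oa _] := dihedral_card_order.
rewrite -eqz_mod_dvd /rotation eq_expg_mod_order oa -!(inj_eq (can_inj absz_nat)).
by rewrite -!modz_nat !gez0_abs ?modz_ge0 // !modz_mod.
Qed.

Lemma rotationD x y : rotation (x + y) = rotation x * rotation y.
Proof.
rewrite [X in X * _]/rotation [X in _ * X]/rotation -expgD -rotation_nat.
apply/eqP; rewrite rotation_eq PoszD !gez0_abs ?modz_ge0 //.
by rewrite -eqz_mod_dvd modzDm.
Qed.

Lemma rotation0 : rotation 0 = 1.
Proof. by rewrite (rotation_nat 0). Qed.

Lemma rotationN x : rotation (- x) = (rotation x)^-1.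
Proof. by apply/esym/eqP; rewrite eq_invg_mul -rotationD subrr rotation0. Qed.

Lemma rotation_aJb x : rotation x ^ b = rotation (- x).
Proof. by rewrite rotationN /rotation conjXg dihedral_aJb expgVn. Qed.

Lemma reflection_eq x y : (reflection x == reflection y) = (n %| x - y)%Z.
Proof. by rewrite (inj_eq (mulIg b)) rotation_eq. Qed.

Lemma rotationC_b x : b * rotation x = rotation (- x) * b.
Proof. by rewrite -rotation_aJb conjgE dihedral_bV -!mulgA dihedral_b2 mulg1. Qed.

Lemma dihedral_elt g : (exists x, g = rotation x) \/ (exists x, g = reflection x).
Proof.
have : g \in <[a]> * <[b]> by rewrite dihedral_genE inE.
case/mulsgP=> _ _ /cycleP[i ->] /cycleP[k ->] ->.
rewrite -rotation_nat -[k]odd_double_half expgD -muln2 mulnC expgM.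
rewrite expg2 dihedral_b2 expg1n mulg1.
case: (odd k); first by right; exists i; rewrite expg1.
by left; exists i; rewrite expg0 mulg1.
Qed.

(** Otherwise b would be a power of a, and the group would have n elements. *)
Lemma rotation_neq_reflection x y : rotation x != reflection y.
Proof.
have [oa oG] := dihedral_card_order.
apply/negP => /eqP rot_b.
have ab : b \in <[a]>.
  have -> : b = rotation (x - y).
    by rewrite addrC rotationD rotationN rot_b /reflection mulKg.
  exact: mem_cycle.
have := dihedral_genE; rewrite (mulGSid _) ?cycle_subG //.
move/(congr1 (fun A : {set gT} => #|A|)); rewrite cardsT oG -orderE oa; lia.
Qed.

Lemma rotationJ_rotation x y : rotation x ^ rotation y = rotation x.
Proof. by rewrite conjgE -rotationN -!rotationD addrC addrK. Qed.

Lemma rotationJ_reflection x y : rotation x ^ reflection y = rotation (- x).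
Proof. by rewrite conjgM rotationJ_rotation rotation_aJb. Qed.

Lemma reflectionJ_rotation x y :
  reflection x ^ rotation y = reflection (x - y *+ 2).
Proof.
rewrite conjgE -rotationN -[reflection x * _]mulgA rotationC_b /reflection.
by rewrite !mulgA -!rotationD; congr (rotation _ * _); lia.
Qed.

Lemma reflectionJ_reflection x y :
  reflection x ^ reflection y = reflection (y *+ 2 - x).
Proof.
rewrite conjgM reflectionJ_rotation conjMg rotation_aJb.
by rewrite conjgE mulKg; congr (rotation _ * _); lia.
Qed.

End Dihedral.

(** * The index set and the classes under conjugation by the image *)

Lemma mem_bigcup_nat (T : finType) (lo hi : nat) (A : nat -> {set T}) (x : T) :
  reflect (exists2 u, (lo <= u < hi)%N & x \in A u)
          (x \in \bigcup_(lo <= u < hi) A u).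
Proof.
have -> : (x \in \bigcup_(lo <= u < hi) A u)
    = has (fun u => x \in A u) (index_iota lo hi).
  by elim: index_iota => [|u us IH] /=; rewrite ?big_nil ?big_cons !inE ?IH.
by apply: (iffP hasP) => [] [u u_in xA]; exists u => //;
  rewrite mem_index_iota in u_in *.
Qed.

Section Transversal.

Variables (n : nat) (gT : finGroupType) (a b : gT).
Hypotheses (n_gt1 : (1 < n)%N) (n_odd : odd n) (dih_ab : is_dihedral n a b).
Variables s j0 : nat.

Local Notation d := (gcdn n s).
Local Notation m := (n %/ d)%N.
Local Notation r := ((d - 1) %/ 2)%N.
Local Notation h := ((n - 1) %/ 2)%N.
Local Notation S := (basis_index a b n s m d j0).
Local Notation rot := (rotation n a).
Local Notation ref := (reflection n a b).

Let rot_eq := rotation_eq n_gt1 dih_ab.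
Let ref_eq := reflection_eq n_gt1 dih_ab.
Let rotP x y : (n %| x - y)%Z -> rot x = rot y.
Proof. by rewrite -rot_eq => /eqP. Qed.
Let refP x y : (n %| x - y)%Z -> ref x = ref y.
Proof. by rewrite -ref_eq => /eqP. Qed.

(** With u = j0 + v, the exponent u is j0 + v and the exponent 2 j0 - u is
    j0 - v, so the two families of reflections are symmetric about j0. *)
Lemma basis_indexP g :
  reflect [\/ exists2 k : nat, (1 <= k <= h)%N & g = rot k,
    exists2 v : nat, (v <= r)%N & exists2 i : nat, (1 <= i < m)%N &
      g = ref (2 * s%:Z * i%:Z + (j0%:Z + v%:Z)) |
    exists2 v : nat, (1 <= v <= r)%N & exists2 i : nat, (i < m)%N &
      g = ref (2 * s%:Z * i%:Z + (j0%:Z - v%:Z))] (g \in S).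
Proof.
have rotX (k : nat) : (a ^+ k)%g = rot k by rewrite (rotation_nat n_gt1 dih_ab).
have rotD := rotationD n_gt1 dih_ab.
have rotN := rotationN n_gt1 dih_ab.
have reflE1 (i u : nat) : (a ^+ (2 * s * i) * a ^+ u * b)%g
    = ref (2 * s%:Z * i%:Z + u%:Z) by rewrite !rotX -rotD !PoszM.
have reflE2 (i u : nat) : (a ^+ (2 * s * i) * (a ^+ (2 * j0) * a ^- u) * b)%g
    = ref (2 * s%:Z * i%:Z + (2 * j0%:Z - u%:Z)).
  by rewrite !rotX -rotN -!rotD !PoszM.
rewrite /basis_index 2!in_setU -orbA; apply: (iffP or3P) => [].
  case=> [/imsetP[k]|/mem_bigcup_nat[u u_bnd /imsetP[i]]|].
  - by rewrite inE => k_bnd ->; constructor 1; exists k; rewrite ?rotX.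
  - rewrite inE => i_gt0 ->; constructor 2; exists (u - j0)%N; first lia.
    exists i; first by rewrite i_gt0 /=.
    by rewrite reflE1; congr (ref (_ + _)); lia.
  case/mem_bigcup_nat=> u u_bnd /imsetP[i _ ->].
  constructor 3; exists (u - j0)%N; first lia.
  by exists i => //; rewrite reflE2; congr (ref (_ + _)); lia.
case=> [[k k_bnd ->]|[v v_bnd [i i_bnd ->]]|[v v_bnd [i i_bnd ->]]].
- have k_lt : (k < n)%N by lia.
  by constructor 1; apply/imsetP; exists (Ordinal k_lt); rewrite ?inE ?rotX.
- have /andP[i_gt0 i_lt] := i_bnd.
  constructor 2; apply/mem_bigcup_nat; exists (j0 + v)%N; first lia.
  by apply/imsetP; exists (Ordinal i_lt); rewrite ?inE ?reflE1.
constructor 3; apply/mem_bigcup_nat; exists (j0 + v)%N; first lia.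
apply/imsetP; exists (Ordinal i_bnd); rewrite ?inE // reflE2.
by congr (ref (_ + _)); lia.
Qed.

Let d_dvd_n : (d %| n%:Z)%Z. Proof. by rewrite dvdzE dvdn_gcdl. Qed.
Let d_dvd_s : (d %| s%:Z)%Z. Proof. by rewrite dvdzE dvdn_gcdr. Qed.
Let d_gt0 : (0 < d)%N. Proof. by rewrite gcdn_gt0; case: n n_odd. Qed.
Let d_odd : odd d. Proof. exact: dvdn_odd (dvdn_gcdl n s) n_odd. Qed.
Let dvd_d x : (n %| x)%Z -> (d %| x)%Z. Proof. exact: dvdz_trans. Qed.
Let n_gt0 : (0 < n)%N. Proof. exact: ltnW. Qed.

(** Every reflection exponent is, modulo d, j0 + v or j0 - v with v at most
    (d-1)/2. All those of the second kind with v > 0 are in S, and of each kind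
    j0 + v exactly one is left out, the one for i = 0. *)
Lemma basis_indexCP g :
  reflect ((exists2 k : nat, (k <= h)%N & g = rot (- k%:Z)) \/
           (exists2 v : nat, (v <= r)%N & g = ref (j0%:Z + v%:Z)))
          (g \notin S).
Proof.
apply: (iffP idP) => [gS|gC].
  have [[x gE]|[x gE]] := dihedral_elt n_gt1 dih_ab g; [left|right].
    have [[k k_le nk]|[k k_bnd nk]] := residue_split (- x) n_odd.
      exists k => //; rewrite gE; apply: rotP.
      by rewrite (_ : _ - _ = - (- x - k%:Z)) ?rpredN //; ring.
    case/basis_indexP: gS; constructor 1; exists k => //.
    by rewrite gE; apply: rotP; rewrite (_ : _ - _ = - (- x + k%:Z)) ?rpredN //; ring.
  have [[v v_le dv]|[v v_bnd dv]] := residue_split (x - j0%:Z) d_odd.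
    have [i i_lt ni] := multiple_mod n_odd dv.
    have [i0|i_gt0] := posnP i.
      exists v => //; rewrite gE; apply: refP; apply: etrans ni.
      by congr (_ %| _)%Z; rewrite i0; ring.
    case/basis_indexP: gS; constructor 2; exists v => //; exists i.
      by rewrite i_gt0.
    by rewrite gE; apply: refP; apply: etrans ni; congr (_ %| _)%Z; ring.
  have [i i_lt ni] := multiple_mod n_odd dv.
  case/basis_indexP: gS; constructor 3; exists v => //; exists i => //.
  by rewrite gE; apply: refP; apply: etrans ni; congr (_ %| _)%Z; ring.
apply/basis_indexP=> gS.
case: gC => [[k k_le gE]|[v v_le gE]].
  rewrite gE in gS.
  case: gS => [[l l_bnd /eqP]|[v _ [i _ /eqP]]|[v _ [i _ /eqP]]].
  - have [l_gt0 l_le] := andP l_bnd.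
    rewrite rot_eq -opprD rpredN => /(dvdz_add_small k_le l_le n_gt0)[_ l0].
    by rewrite l0 in l_gt0.
  - by apply/negP; apply: rotation_neq_reflection.
  - by apply/negP; apply: rotation_neq_reflection.
rewrite gE in gS.
case: gS => [[k _ /eqP]|[w w_le [i i_bnd /eqP]]|[w w_bnd [i i_lt /eqP]]].
- by apply/negP; rewrite eq_sym; apply: rotation_neq_reflection.
- rewrite ref_eq => ni; have [i_gt0 i_lt] := andP i_bnd.
  have vw : v = w.
    apply: (dvdz_sub_small v_le w_le d_gt0).
    rewrite (_ : _ - _ = (j0%:Z + v%:Z - (2 * s%:Z * i%:Z + (j0%:Z + w%:Z)))
      + s%:Z * (2 * i%:Z)); last by ring.
    by rewrite rpredD ?dvdz_mulr // dvd_d.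
  suff i0 : i = 0%N by rewrite i0 in i_gt0.
  apply: (multiple_eq0 n_odd i_lt); rewrite -rpredN; apply: etrans ni.
  by congr (_ %| _)%Z; rewrite vw; ring.
have [w_gt0 w_le] := andP w_bnd; rewrite ref_eq => ni.
suff [_ w0] : v = 0%N /\ w = 0%N by rewrite w0 in w_gt0.
apply: (dvdz_add_small v_le w_le d_gt0).
rewrite (_ : _ + _ = (j0%:Z + v%:Z - (2 * s%:Z * i%:Z + (j0%:Z - w%:Z)))
  + s%:Z * (2 * i%:Z)); last by ring.
by rewrite rpredD ?dvdz_mulr // dvd_d.
Qed.

Lemma card_basis_index : (#|S| + h.+1 + r.+1)%N = n.*2.
Proof.
pose A := [set rot (- k%:Z) | k : 'I_h.+1].
pose B := [set ref (j0%:Z + v%:Z) | v : 'I_r.+1].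
have [_ <-] := dihedral_card_order n_gt1 dih_ab.
have SC : ~: S = A :|: B.
  apply/setP=> g; rewrite in_setC in_setU; apply/basis_indexCP/orP.
    case=> [[k k_le ->]|[v v_le ->]]; [left|right].
      by apply/imsetP; exists (Ordinal (k_le : (k < h.+1)%N)).
    by apply/imsetP; exists (Ordinal (v_le : (v < r.+1)%N)).
  case=> /imsetP[[k k_lt] _ ->]; first by left; exists k.
  by right; exists k.
have AB0 : A :&: B = set0.
  apply/setP=> g; rewrite !inE; apply/negP=> /andP[/imsetP[k _ ->] /imsetP[v _ /eqP]].
  by apply/negP; apply: rotation_neq_reflection.
have cA : #|A| = h.+1.
  rewrite card_imset ?card_ord // => k l /eqP; rewrite rot_eq -opprB opprK addrC.
  rewrite rpredN => /(dvdz_sub_small (ltn_ord k) (ltn_ord l) n_gt0) ?.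
  exact: val_inj.
have cB : #|B| = r.+1.
  rewrite card_imset ?card_ord // => v w /eqP; rewrite ref_eq.
  rewrite opprD addrACA subrr add0r => /dvd_d.
  by move/(dvdz_sub_small (ltn_ord v) (ltn_ord w) d_gt0)/val_inj.
by rewrite -(cardsC S) SC cardsU AB0 cards0 subn0 cA cB addnA.
Qed.

Variables (t : nat) (phi : {morphism [set: gT] >-> gT}).
Hypotheses (phi_a : phi a = (a ^+ s)%g) (phi_b : phi b = (a ^+ t * b)%g).
Hypothesis t_j0 : t = j0 %[mod s].
Local Notation H := (phi @* [set: gT])%g.

Lemma image_rotation x : phi (rot x) = rot (s%:Z * x).
Proof.
rewrite {1}/rotation morphX ?inE // phi_a -expgM -(rotation_nat n_gt1 dih_ab).
apply: rotP; rewrite PoszM -mulrBr dvdz_mull //.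
by rewrite gez0_abs ?modz_ge0 -?eqz_mod_dvd ?modz_mod //; lia.
Qed.

Lemma image_reflection x : phi (ref x) = ref (s%:Z * x + t%:Z).
Proof.
rewrite morphM ?inE // image_rotation phi_b mulgA /reflection.
by rewrite (rotationD n_gt1 dih_ab) (rotation_nat n_gt1 dih_ab).
Qed.

Lemma image_elt g : g \in H ->
  exists x, g = rot (s%:Z * x) \/ g = ref (s%:Z * x + t%:Z).
Proof.
case/morphimP=> k _ _ ->.
have [[x ->]|[x ->]] := dihedral_elt n_gt1 dih_ab k; exists x.
  by left; apply: image_rotation.
by right; apply: image_reflection.
Qed.

Lemma image_rotation_mem x : rot (s%:Z * x) \in H.
Proof. by rewrite -image_rotation mem_morphim ?inE. Qed.

Lemma image_reflection_mem x : ref (s%:Z * x + t%:Z) \in H.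
Proof. by rewrite -image_reflection mem_morphim ?inE. Qed.

Let d_dvd_tj : (d %| t%:Z - j0%:Z)%Z.
Proof.
apply: (dvdz_trans d_dvd_s); rewrite -eqz_mod_dvd.
by rewrite !modz_nat eqz_nat; apply/eqP.
Qed.

(** Two exponents k, l of rotations outside S could only be matched by a
    reflection, which forces k + l = 0 modulo n, hence k = l = 0; likewise, for
    two reflections, rotations force v = w and reflections v + w = 0 modulo d,
    hence v = w = 0. *)
Lemma image_class_misses_unique u g :
  u \notin S -> g \in H -> (u ^ g)%g \notin S -> (u ^ g)%g = u.
Proof.
move=> /basis_indexCP uC /image_elt[y gE] /basis_indexCP.
have rotJrot := rotationJ_rotation n_gt1 dih_ab.
have rotJref := rotationJ_reflection n_gt1 dih_ab.
have refJrot := reflectionJ_rotation n_gt1 dih_ab.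
have refJref := reflectionJ_reflection n_gt1 dih_ab.
case: uC => [[k k_le ->]|[v v_le ->]]; case: gE => ->.
- by rewrite rotJrot.
- rewrite rotJref => -[[l l_le /eqP]|[w _ /eqP]]; last first.
    by rewrite (negPf (rotation_neq_reflection n_gt1 dih_ab _ _)).
  rewrite rot_eq !opprK => nkl.
  by have [-> _] := dvdz_add_small k_le l_le n_gt0 nkl; rewrite !oppr0.
- rewrite refJrot => -[[l _ /eqP]|[w w_le /eqP]].
    by rewrite eq_sym (negPf (rotation_neq_reflection n_gt1 dih_ab _ _)).
  move=> E; rewrite (eqP E); move: E; rewrite ref_eq => /dvd_d ni.
  suff -> : v = w by [].
  apply: (dvdz_sub_small v_le w_le d_gt0).
  rewrite (_ : _ - _ = (j0%:Z + v%:Z - (s%:Z * y) *+ 2 - (j0%:Z + w%:Z))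
    + s%:Z * (2 * y)); last by ring.
  by rewrite rpredD ?dvdz_mulr.
rewrite refJref => -[[l _ /eqP]|[w w_le /eqP]].
  by rewrite eq_sym (negPf (rotation_neq_reflection n_gt1 dih_ab _ _)).
move=> E; rewrite (eqP E); move: E; rewrite ref_eq => /dvd_d ni.
suff [-> ->] : v = 0%N /\ w = 0%N by [].
apply: (dvdz_add_small v_le w_le d_gt0).
rewrite (_ : _ + _ = - ((s%:Z * y + t%:Z) *+ 2 - (j0%:Z + v%:Z) - (j0%:Z + w%:Z))
  + (s%:Z * (2 * y) + (t%:Z - j0%:Z) * 2)); last by ring.
by rewrite rpredD ?rpredN // rpredD ?dvdz_mulr.
Qed.

(** Conjugating by a reflection of the image changes the sign of the balanced
    residue of the exponent, which can so be given the sign required outside S;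
    multiples of d are then corrected by [multiple_mod]. *)
Lemma image_class_misses g : exists2 u, u \in (g ^: H)%g & u \notin S.
Proof.
have [[x ->]|[x ->]] := dihedral_elt n_gt1 dih_ab g.
  have [[k k_le nk]|[k k_bnd nk]] := residue_split x n_odd.
    exists (rot (- x)).
      rewrite -(rotationJ_reflection n_gt1 dih_ab x (s%:Z * 0 + t%:Z)).
      exact/memJ_class/image_reflection_mem.
    apply/basis_indexCP; left; exists k => //; apply: rotP.
    by rewrite -opprD rpredN; apply: etrans nk; congr (_ %| _)%Z; ring.
  exists (rot x); first exact: class_refl.
  apply/basis_indexCP; left; exists k; first by case/andP: k_bnd.
  by apply: rotP; rewrite opprK.
have [[v v_le dv]|[v v_bnd dv]] := residue_split (x - j0%:Z) d_odd.
  have [i _ ni] := multiple_mod n_odd dv.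
  exists (ref (x - (s%:Z * i%:Z) *+ 2)).
    rewrite -(reflectionJ_rotation n_gt1 dih_ab).
    exact/memJ_class/image_rotation_mem.
  apply/basis_indexCP; right; exists v => //; apply: refP.
  by apply: etrans ni; congr (_ %| _)%Z; ring.
have dz : (d %| x - j0%:Z + v%:Z - (t%:Z - j0%:Z) * 2)%Z.
  by rewrite rpredB ?dvdz_mulr.
have [i _ ni] := multiple_mod n_odd dz.
exists (ref ((s%:Z * i%:Z + t%:Z) *+ 2 - x)).
  rewrite -(reflectionJ_reflection n_gt1 dih_ab).
  exact/memJ_class/image_reflection_mem.
apply/basis_indexCP; right; exists v; first by case/andP: v_bnd.
apply: refP; rewrite -rpredN; apply: etrans ni; congr (_ %| _)%Z; ring.
Qed.

Lemma card_image_class_misses g : #|(g ^: H :\: S)%g| = 1%N.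
Proof.
have [u ug uS] := image_class_misses g; apply/eqP/cards1P; exists u.
apply/setP=> w; rewrite in_setD in_set1; apply/andP/eqP=> [[wS]|->]; last by [].
rewrite -(class_eqP ug) => /imsetP[k kH wE].
by rewrite wE image_class_misses_unique // -wE.
Qed.

End Transversal.

Theorem theorem5p11 (F : fieldType) (n : nat) (n_ge3 : (3 <= n)%N)
    (n_odd : odd n) (gT : finGroupType) (a b : gT)
    (dihedral_ab : is_dihedral n a b)
    (s t : nat) (s_bounds : (1 <= s <= n - 1)%N) (t_bounds : (t <= n - 1)%N)
    (phi : {morphism [set: gT] >-> gT})
    (phi_a : phi a = (a ^+ s)%g) (phi_b : phi b = (a ^+ t * b)%g)
    (j0 : nat) (j0_lt : (j0 < s)%N) (t_j0 : t = j0 %[mod s]) :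
  let sigma0 : {lrmorphism galg F gT -> galg F gT} := @galg_ext F gT gT phi in
  let m := #[phi a]%g in
  let d := (n %/ m)%N in
  let S := basis_index a b n s m d j0 in
  (\dim (Inn sigma0))%:Q = (3 * n%:Q - d%:Q) / 2 - 1 /\
  basis_of (Inn sigma0) [seq inner_der sigma0 (galg_elt F g) | g in S].
Proof.
(* The final count, for c = #|S|, e = d and k = n. *)
have halves (c e k : nat) : odd e -> odd k ->
    (c + ((k - 1) %/ 2).+1 + ((e - 1) %/ 2).+1 = k.*2)%N ->
  (c * 2 + e + 2 = 3 * k)%N by clear; lia.
have n_gt1 : (1 < n)%N by apply: leq_trans n_ge3.
have n_gt0 : (0 < n)%N by apply: ltnW.
have [oa _] := dihedral_card_order n_gt1 dihedral_ab.
move=> sigma0 m d.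
have mE : m = (n %/ gcdn n s)%N by rewrite /m phi_a orderXgcd oa.
have dE : d = gcdn n s by rewrite /d mE divnA ?dvdn_gcdl ?mulKn.
rewrite dE mE => S.
have basisS : basis_of (Inn sigma0) [seq inner_der sigma0 (galg_elt F g) | g in S].
  by apply: basis_inner_der; apply: card_image_class_misses t_j0.
split=> //.
have dimE : \dim (Inn sigma0) = #|S|.
  by rewrite (size_basis (X := in_tuple _) basisS) size_image.
have d_odd : odd (gcdn n s) := dvdn_odd (dvdn_gcdl n s) n_odd.
have /(congr1 (fun k : nat => k%:R : rat)) :=
  halves _ _ _ d_odd n_odd (card_basis_index n_gt1 n_odd dihedral_ab s j0).
rewrite -/S (natrM _ 3) (natrD _ (_ + _)) (natrD _ (_ * 2)) natrM => cardS.
by rewrite dimE -!pmulrn -cardS; field.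
Qed.
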